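(* If $X$ is a weakly Lindelöf determined real Banach space, then $X$ has the $c_0$-extension property with constant $2$.
   Context: A compact Hausdorff space $K$ is a Corson compactum if there exists a set $I$ such that $K$ is homeomorphic to a closed subset of $\Sigma(I)$, endowed with the product topology, where $\Sigma(I)\subset\mathbb{R}^I$ is the set of functions with countable support. A Banach space $X$ is weakly Lindelöf determined (WLD) if its closed dual unit ball $B_{X^*}$ with the weak-star topology is a Corson compactum. For a real number $\lambda\ge 1$, a Banach space $X$ has the $c_0$-extension property with constant $\lambda$ if every bounded linear operator $T:Y\to c_0$ defined on a closed subspace $Y$ of $X$ admits a bounded linear extension $\tilde T:X\to c_0$ with $\|\tilde T\|\le\lambda\|T\|$. *)

(* Defs.v *)
From HB Require Import structures.
From mathcomp Require Import all_boot all_order all_algebra.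
From mathcomp Require Import all_classical all_reals all_analysis.

Set Implicit Arguments.
Unset Strict Implicit.
Unset Printing Implicit Defensive.

Import Order.TTheory GRing.Theory Num.Theory.
Import numFieldNormedType.Exports.

Local Open Scope classical_set_scope.
Local Open Scope ring_scope.

Definition homeomorphic (S T : topologicalType) : Prop :=
  exists (f : S -> T) (g : T -> S),
    [/\ continuous f, continuous g, cancel f g & cancel g f].

Definition Sigma (R : realType) (I : Type) : set {ptws I -> R} :=
  [set x | countable [set i | x i != 0]].
Arguments Sigma : clear implicits.

(* [C] is closed in [Sigma R I], not necessarily in the whole product; sets
   coerce to subtypes carrying the induced topology. *)
Definition Corson_compactum (R : realType) (K : topologicalType) : Prop :=
  [/\ compact [set: K], hausdorff_space K &
      exists (I : Type) (C : set (Sigma R I)), closed C /\ homeomorphic K C].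

(* The operator norm; it has its usual meaning only for bounded operators, [sup]
    being [0] on sets that have no upper bound. *)
Definition opnorm (R : realType) (V W : normedModType R) (f : V -> W) : R :=
  sup [set `|f x| | x in [set x : V | `|x| <= 1]].

(* The weak-star topology is the topology of pointwise convergence on [X], which
   is why the ball lives in [{ptws X -> R^o}]. *)
Definition dual_ball (R : realType) (X : normedModType R) :
    set {ptws X -> R^o} :=
  [set f | [/\ linear (f : X -> R^o), bounded_near (f : X -> R^o) (nbhs (0 : X))
             & opnorm (f : X -> R^o) <= 1]].
Arguments dual_ball {R} X.

Definition weakly_Lindelof_determined (R : realType) (X : normedModType R) :
    Prop :=
  Corson_compactum R (dual_ball X).

Definition submod (R : realType) (X : normedModType R) (Y : submodClosed X) :
  Type := {x : X | x \in Y}.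

Section submod_normed.
Context (R : realType) (X : normedModType R) (Y : submodClosed X).

HB.instance Definition _ := SubChoice.on (submod Y).
HB.instance Definition _ := [SubChoice_isSubLmodule of submod Y by <:].

Let submod_norm (y : submod Y) : R := `|\val y|.

Let submod_normD x y : submod_norm (x + y) <= submod_norm x + submod_norm y.
Proof. by rewrite /submod_norm raddfD ler_normD. Qed.

Let submod_normZ (l : R) x : submod_norm (l *: x) = `|l| * submod_norm x.
Proof. by rewrite /submod_norm linearZ/= normrZ. Qed.

Let submod_norm0_eq0 x : submod_norm x = 0 -> x = 0.
Proof. by move=> /normr0_eq0 x0; apply: val_inj; rewrite x0 raddf0. Qed.

HB.instance Definition _ := @Lmodule_isNormed.Build R (submod Y) submod_norm
  submod_normD submod_normZ submod_norm0_eq0.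

Lemma submod_normE (y : submod Y) : `|y| = `|\val y|.
Proof. by []. Qed.

End submod_normed.

Definition c0_pred (R : realType) : {pred nat -> R^o} :=
  [pred u : nat -> R^o | `[< u n @[n --> \oo] --> (0 : R^o) >]].

Section c0_submod.
Context (R : realType).

Let c0_submod_closed : submod_closed (@c0_pred R).
Proof.
split; first by apply/asboolP; exact: cvg_cst.
move=> a u v /asboolP u0 /asboolP v0; apply/asboolP.
have := cvgD (cvgZl_tmp (k := a) u0) v0.
rewrite scaler0 addr0; exact.
Qed.

HB.instance Definition _ :=
  GRing.isSubmodClosed.Build R (nat -> R^o) (@c0_pred R) c0_submod_closed.

End c0_submod.

Definition c0 (R : realType) : Type := {u : nat -> R^o | u \in @c0_pred R}.

Section c0_normed.
Context (R : realType).

HB.instance Definition _ := SubChoice.on (c0 R).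
HB.instance Definition _ := [SubChoice_isSubLmodule of c0 R by <:].

Let c0_norm (u : c0 R) : R := sup (range (fun n => `|(\val u) n|)).

Lemma c0_has_sup (u : c0 R) : has_sup (range (fun n => `|(\val u) n|)).
Proof.
split; first by exists `|(\val u) 0%N|; exists 0%N.
have /asboolP u0 := valP u.
have /cvg_seq_bounded/bounded_fun_has_ubound : cvgn (fun n => `|(\val u) n|).
  by apply: is_cvg_norm; apply/cvg_ex; exists 0.
by [].
Qed.

Let c0_le_norm (u : c0 R) n : `|(\val u) n| <= c0_norm u.
Proof. by apply: sup_upper_bound; [exact: c0_has_sup|exists n]. Qed.

Let c0_norm_le (u : c0 R) (M : R) :
  (forall n, `|(\val u) n| <= M) -> c0_norm u <= M.
Proof.
by move=> uM; apply: sup_le_ub => [|_ [n _ <-]//]; case: (c0_has_sup u).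
Qed.

Let c0_normD u v : c0_norm (u + v) <= c0_norm u + c0_norm v.
Proof.
apply: c0_norm_le => n; rewrite raddfD/=.
by rewrite (le_trans (ler_normD _ _))// lerD ?c0_le_norm.
Qed.

Let c0_normZ (l : R) u : c0_norm (l *: u) = `|l| * c0_norm u.
Proof.
apply/eqP; rewrite eq_le; apply/andP; split.
  apply: c0_norm_le => n; rewrite linearZ/= normrZ.
  by rewrite ler_wpM2l ?c0_le_norm.
have [->|l0] := eqVneq l 0.
  rewrite normr0 mul0r; exact: le_trans (c0_le_norm _ 0%N).
rewrite -ler_pdivlMl ?normr_gt0//; apply: c0_norm_le => n.
rewrite ler_pdivlMl ?normr_gt0// -normrZ.
by have := c0_le_norm (l *: u) n; rewrite linearZ.
Qed.

Let c0_norm0_eq0 u : c0_norm u = 0 -> u = 0.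
Proof.
move=> u0; apply: val_inj; rewrite raddf0; apply/funext => n /=.
by apply/eqP; rewrite -normr_le0 -u0 c0_le_norm.
Qed.

HB.instance Definition _ := @Lmodule_isNormed.Build R (c0 R) c0_norm
  c0_normD c0_normZ c0_norm0_eq0.

Lemma c0_normE (u : c0 R) : `|u| = sup (range (fun n => `|(\val u) n|)).
Proof. by []. Qed.

End c0_normed.

Definition c0_extension_property (R : realType) (X : normedModType R)
    (lambda : R) : Prop :=
  forall (Y : submodClosed X) (T : {linear submod Y -> c0 R}),
    closed [set` Y] -> bounded_near T (nbhs (0 : submod Y)) ->
    exists T' : {linear X -> c0 R},
      [/\ bounded_near T' (nbhs (0 : X)), forall y : submod Y, T' (\val y) = T y
        & opnorm T' <= lambda * opnorm T].

(* Main.v *)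
(* Hahn-Banach extends the coordinates of [T], scaled by [1 / opnorm T], to
   functionals [F n] in the dual ball [K].  Since [K] is a Corson compactum, the
   [F n] lie in a closed set [L] whose points are separated by countably many
   continuous functions, that is, a metrizable one.  As [T] takes values in
   [c0], every cluster point of [F] vanishes on [Y]; hence the distance from
   [F n] to the annihilator of [Y] in [L] tends to [0], and there are [g n] in
   [K], null on [Y], such that [F n - g n] tends weak-star to [0].  The operator
   [x |-> opnorm T * (F n x - g n x)] is the required extension; the constant
   [2] comes from [`|F n - g n| <= 2]. *)

From HB Require Import structures.
Require Import Defs.
From mathcomp Require Import all_boot all_order all_algebra.
From mathcomp Require Import all_classical all_reals all_analysis.
From mathcomp Require Import lra.

Set Implicit Arguments.
Unset Strict Implicit.
Unset Printing Implicit Defensive.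

Import Order.TTheory GRing.Theory Num.Theory.
Import numFieldNormedType.Exports.

Local Open Scope classical_set_scope.
Local Open Scope ring_scope.

Lemma linear_funP (R : pzRingType) (V W : lmodType R) (f : V -> W) :
  linear f -> exists g : {linear V -> W}, g = f :> (V -> W).
Proof.
move=> lf; pose l := GRing.isLinear.Build R V W _ f lf.
by exists (HB.pack f l : {linear V -> W}).
Qed.

(** * Hahn-Banach extension with a norm bound *)

Section hahn_banach.
Context (R : realType) (V : normedModType R).
Implicit Types (G : set (V * R)) (M : R).

(** A functional on a subspace is encoded by its graph. Single-valuedness is left out because it
    follows: a difference [(0, r)] of two points over the same vector satisfies [r <= 0], and so
    does its opposite. *)
Let dominated_graph M G :=
  (forall (a : R) u v, G u -> G v -> G (a *: u.1 + v.1, a * u.2 + v.2)) /\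
  (forall u, G u -> u.2 <= M * `|u.1|).

(** The value [c] at [x] must lie above every [z.2 - M * |z.1 - x|] and below every
    [M * |y.1 + x| - y.2]. The triangle inequality puts the first family below the second, so the
    supremum of the first will do. *)
Let dominated_graph_extend M G (x : V) : 0 <= M ->
  G (0, 0) -> dominated_graph M G ->
  exists c : R, dominated_graph M
    [set u | exists2 y, G y & exists t, u = (y.1 + t *: x, y.2 + t * c)].
Proof.
move=> M0 G0 [Glin Gle].
have Gdiff y z : G y -> G z -> z.2 - M * `|z.1 - x| <= M * `|y.1 + x| - y.2.
  move=> Gy Gz; have := Gle _ (Glin 1 _ _ Gy Gz).
  rewrite /= scale1r mul1r => yz.
  have := ler_wpM2l M0 (ler_normD (y.1 + x) (z.1 - x)).
  rewrite addrACA subrr addr0; lra.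
pose S := [set z.2 - M * `|z.1 - x| | z in G].
have S0 : S !=set0 by exists (0 - M * `|0 - x|), (0, 0).
have Sub y : G y -> ubound S (M * `|y.1 + x| - y.2).
  by move=> Gy _ [z Gz <-]; exact: Gdiff.
have supS : has_sup S by split=> //; eexists; exact: Sub G0.
exists (sup S); split.
  move=> a _ _ [y Gy [t ->]] [z Gz [s ->]] /=.
  exists (a *: y.1 + z.1, a * y.2 + z.2); first exact: Glin.
  exists (a * t + s); rewrite /= scalerDr scalerDl scalerA mulrDr mulrDl mulrA.
  by rewrite addrACA [a * y.2 + _ + _]addrACA.
have Gscale (a : R) y : G y -> G (a *: y.1, a * y.2).
  by move=> Gy; have := Glin a _ _ Gy G0; rewrite /= !addr0.
have pull a z : 0 < a -> a * (M * `|z|) = M * `|a *: z|.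
  by move=> a0; rewrite normrZ gtr0_norm// mulrCA.
(* Dividing [y] by [|t|] reduces to [t = -1], where [c] bounds the lower family from above, or to
   [t = 1], where [c] is at most every upper bound. *)
move=> _ [y Gy [t ->]] /=; have [t0|t0|->] := ltgtP t 0; last 1 first.
- by rewrite scale0r mul0r !addr0; exact: Gle.
- have /(sup_upper_bound supS) : S ((- t)^-1 * y.2 - M * `|(- t)^-1 *: y.1 - x|).
    by exists ((- t)^-1 *: y.1, (- t)^-1 * y.2) => //; exact: Gscale.
  have nt0 : 0 < - t by rewrite oppr_gt0.
  move=> /(ler_wpM2l (ltW nt0)).
  rewrite mulrBr mulVKf ?gt_eqF// pull// scalerBr scalerA.
  rewrite divff ?gt_eqF// scale1r scaleNr opprK; lra.
- have /(_ S0) := sup_le_ub _ (Sub _ (Gscale t^-1 _ Gy)).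
  move=> /(ler_wpM2l (ltW t0)) /=.
  rewrite mulrBr mulVKf ?gt_eqF// pull// scalerDr scalerA.
  rewrite divff ?gt_eqF// scale1r; lra.
Qed.

Theorem hahn_banach_dominated (Y : submodClosed V) (f : {linear submod Y -> R^o}) M :
  0 <= M -> (forall y, `|f y| <= M * `|y|) ->
  exists g : {linear V -> R^o},
    (forall y, g (val y) = f y) /\ (forall x, `|g x| <= M * `|x|).
Proof.
move=> M0 fM.
pose G0 : set (V * R) := range (fun y => (val y, f y)).
have G0lin (a : R) u v : G0 u -> G0 v -> G0 (a *: u.1 + v.1, a * u.2 + v.2).
  move=> [y _ <-] [z _ <-] /=; exists (a *: y + z) => //.
  by rewrite !linearP.
have G0le u : G0 u -> u.2 <= M * `|u.1|.
  by move=> [y _ <-] /=; exact: le_trans (ler_norm _) (fM y).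
(* Ordering the added sets [A] rather than the graphs containing [G0] lets the empty chain qualify:
   its union still leaves [G0]. *)
have [|A [domA maxA]] := @Zorn_bigcup _ [set A | dominated_graph M (G0 `|` A)].
  move=> F FP Ftot; split.
    move=> a u v [G0u|[A FA Au]] [G0v|[B FB Bv]].
    - by left; exact: G0lin.
    - have [/(_ a u v)] := FP _ FB.
      by case=> [||?|?]; [left|right|left|right; exists B].
    - have [/(_ a u v)] := FP _ FA.
      by case=> [||?|?]; [right|left|left|right; exists A].
    - have [AB|BA] := Ftot _ _ FA FB.
        have [/(_ a u v)] := FP _ FB.
        by case=> [||?|?]; [right; exact: AB|right|left|right; exists B].
      have [/(_ a u v)] := FP _ FA.
      by case=> [||?|?]; [right|right; exact: BA|left|right; exists A].
  move=> u [G0u|[A FA Au]]; first exact: G0le.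
  by have [_] := FP _ FA; apply; right.
set G := G0 `|` A in domA; have [Glin Gle] := domA.
have G00 : G (0, 0) by left; exists 0 => //; rewrite !linear0.
have Gtotal x : exists r, G (x, r).
  have [c domc] := dominated_graph_extend x M0 G00 domA.
  (* If no value is assigned to [x], the one-dimensional extension [B] contains [(x, c)] and
     strictly exceeds [A], against maximality. *)
  set B := [set u | _] in domc; apply: contrapT => Gx.
  have GB : G `<=` B.
    by move=> u Gu; exists u => //; exists 0; rewrite scale0r mul0r !addr0; case: u Gu.
  apply: (maxA B).
    split; first by move=> u Au; apply: GB; right.
    move=> BA; apply: Gx; exists c; right; apply: BA.
    by exists (0, 0) => //; exists 1; rewrite scale1r mul1r !add0r.
  suff G0B : G0 `|` B = B by rewrite /mkset G0B.
  by apply/setUidPr => u G0u; apply: GB; left.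
have [g Gg] := choice Gtotal.
have Gabs x r : G (x, r) -> `|r| <= M * `|x|.
  move=> Gxr; rewrite ler_norml (Gle _ Gxr) andbT lerNl.
  have := Gle _ (Glin (-1) _ _ Gxr G00).
  by rewrite /= !addr0 scaleN1r mulN1r normrN.
have Guniq x r s : G (x, r) -> G (x, s) -> r = s.
  move=> Gr Gs; have := Gabs _ _ (Glin (-1) _ _ Gr Gs).
  rewrite /= scaleN1r addNr normr0 mulr0 normr_le0 mulN1r addrC subr_eq0.
  by move/eqP.
have glin : linear (g : V -> R^o).
  by move=> a x y; apply: (Guniq (a *: x + y)) => //; exact: Glin (Gg x) (Gg y).
have [h hg] := linear_funP glin.
exists h; rewrite hg; split=> [y|x]; last exact: Gabs.
by apply: (Guniq (val y)) => //; left; exists y.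
Qed.

End hahn_banach.

(** * Sequences in compact spaces, by way of ultrafilters *)

Lemma compact_ultra_cvg (S : Type) (T : topologicalType) (U : set_system S)
    (f : S -> T) :
  UltraFilter U -> compact [set: T] -> exists p : T, f @ U --> p.
Proof.
move=> UU /(_ (f @ U)) [|p [_ clp]]; first exact: filterT.
exists p => A pA; have [//|UAc] := in_ultra_setVsetC (f @^-1` A) UU.
by have [x []] := clp (~` A) A UAc pA.
Qed.

(** The trace of [\oo] on [P] is a proper filter exactly because [P] holds frequently; any
    ultrafilter above it works. Limits along it replace subsequences when an eventual property is
    refuted. *)
Lemma frequently_ultra (P : nat -> Prop) : ~ (\forall n \near \oo, ~ P n) ->
  exists U : set_system nat, [/\ UltraFilter U, U --> \oo & U P].
Proof.
move=> nP; have PF : ProperFilter (within P \oo).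
  by split; [exact: contra_not nP|exact: within_filter].
have [U [UU sU]] := ultraFilterLemma PF.
exists U; split=> // [A ooA|]; apply: sU; first exact: cvg_within ooA.
exact: withinT.
Qed.

Section countably_separated.
Context (R : realType) (K : topologicalType) (L : set K) (phi : nat -> K -> R^o).
Hypotheses (Kco : compact [set: K]) (Lcl : closed L).
Hypothesis phi_cont : forall k, continuous (phi k).
Hypothesis phi_sep : forall a b, L a -> L b -> (forall k, phi k a = phi k b) -> a = b.

(** These relations shrink as [m] grows and stand in for the balls of a metric on [L], so no
    distance has to be defined. *)
Let close m a b := forall k, (k <= m)%N -> `|phi k a - phi k b| < m.+1%:R^-1.

Let close_nbhs m p : \forall a \near p, close m a p.
Proof.
have : \forall a \near p, forall k : 'I_m.+1, `|phi k a - phi k p| < m.+1%:R^-1.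
  apply: filter_forall => k.
  have /cvgr_distC_lt : phi k a @[a --> p] --> phi k p by exact: phi_cont.
  by apply; rewrite invr_gt0.
by apply: filterS => a ap k km; have := ap (Ordinal (km : (k < m.+1)%N)).
Qed.

Let close_le m m' a b : (m <= m')%N -> close m' a b -> close m a b.
Proof.
move=> mm ab k km; apply: lt_le_trans (ab _ (leq_trans km mm)) _.
by rewrite lef_pV2 ?posrE// ler_nat.
Qed.

Let close_cvg (u v : nat -> K) :
  (forall m, \forall n \near \oo, close m (u n) (v n)) ->
  forall k, phi k (u n) - phi k (v n) @[n --> \oo] --> (0 : R^o).
Proof.
move=> uv k; apply/cvgr0Pnorm_lt => e e0.
have [m _ me] : \forall m \near \oo, m.+1%:R^-1 < e.
  by apply: (near_infty_natSinv_lt (PosNum e0)).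
apply: filterS (uv (maxn m k)) => n /(_ k (leq_maxr _ _)) /lt_trans; apply.
by apply: me; exact: leq_maxl.
Qed.

(* [L] is metrized by the [phi k], so the distance from [F n] to the set
   [A `&` L], which contains all cluster points of [F], tends to [0]; [g n]
   is a nearly closest point. *)
Lemma cvg_sub_cluster_subset (A : set K) (F : nat -> K) : A !=set0 ->
  (forall n, L (F n)) -> (cluster (F @ \oo) `<=` A) ->
  exists g : nat -> K, (forall n, A (g n)) /\
    forall psi : K -> R^o, continuous psi ->
      psi (F n) - psi (g n) @[n --> \oo] --> (0 : R^o).
Proof.
move=> [a0 Aa0] LF FA.
pose P m n g := [/\ A g, L g & close m (F n) g].
have evP m : \forall n \near \oo, exists g, P m n g.
  (* Otherwise take an ultrafilter on the bad indices. The limit [p] of [F] along it lies in [A],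
     being a cluster point, and in [L]; so [p] itself is an admissible choice for some bad index. *)
  apply: contrapT => /(@contra_not _ _ (@filterS _ _ _ _ _ _)) nP.
  have [|U [UU Uoo UN]] := @frequently_ultra (fun n => ~ exists g, P m n g).
    by apply: nP => n /contrapT.
  have [p Fp] := compact_ultra_cvg F UU Kco.
  have Lp : L p.
    by apply: (closed_cvg L Lcl _ p Fp); exact: nearW.
  have Ap : A p.
    apply: FA => B C FB pC.
    have UC : U (F @^-1` C) by exact: Fp.
    have [n [? ?]] := filter_ex (filterI (Uoo _ FB) UC).
    by exists (F n).
  have UC : U [set n | close m (F n) p] by exact: Fp (close_nbhs m p).
  have [n [Pn /=]] := filter_ex (filterI UN UC).
  by move=> cl; apply: Pn; exists p.
(* Diagonal choice: [g] realizes the largest [m <= n] for which [P m n] can be satisfied, hence all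
   smaller ones by [close_le]; if there is none, [a0] is taken. *)
have exg n : exists g, A g /\ forall m, (m <= n)%N -> (exists g, P m n g) -> P m n g.
  elim: {1}n => [|k [g [Ag IH]]].
    have [[g Pg]|nP] := pselect (exists g, P 0%N n g).
      by exists g; case: (Pg) => Ag *; split=> // m; rewrite leqn0 => /eqP ->.
    by exists a0; split=> // m; rewrite leqn0 => /eqP ->.
  have [[h Ph]|nP] := pselect (exists g, P k.+1 n g).
    exists h; case: (Ph) => Ah Lh ch; split=> // m mk _; split=> //.
    exact: close_le ch.
  by exists g; split=> // m; rewrite leq_eqVlt => /predU1P[->//|]; exact: IH.
have {exg} [g /all_and2 [Ag gP]] := choice exg.
have Pg m : \forall n \near \oo, P m n (g n).
  near=> n; apply: gP; last by near: n; exact: evP.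
  by near: n; exact: nbhs_infty_ge.
exists g; split=> // psi psi_cont; apply/cvgr0Pnorm_lt => e e0.
apply: contrapT => nlt.
(* Along an ultrafilter on the bad indices, [F] and [g] have limits [p] and [q] in [L] that no
   [phi k] distinguishes. So [p = q], and continuity of [psi] contradicts the choice of indices. *)
have [|U [UU Uoo Ue]] := @frequently_ultra (fun n => ~ (`|psi (F n) - psi (g n)| < e)).
  by apply: contra_not nlt; apply: filterS => n /contrapT.
have [p Fp] := compact_ultra_cvg F UU Kco.
have [q gq] := compact_ultra_cvg g UU Kco.
have pq : p = q.
  apply: phi_sep.
  - by apply: (closed_cvg L Lcl _ p Fp); exact: nearW.
  - apply: (closed_cvg L Lcl _ q gq); apply: Uoo.
    by apply: filterS (Pg 0%N) => n [].
  - move=> k; apply/eqP; rewrite -subr_eq0; apply/eqP.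
    have : phi k (F n) - phi k (g n) @[n --> U] --> (0 : R^o).
      apply: cvg_trans (close_cvg _ k); first exact: cvg_app Uoo.
      by move=> m; apply: filterS (Pg m) => n [].
    have : phi k (F n) - phi k (g n) @[n --> U] --> (phi k p - phi k q : R^o).
      by apply: cvgB; apply: continuous_cvg => //; exact: phi_cont.
    exact: cvg_unique.
have : psi (F n) - psi (g n) @[n --> U] --> (psi p - psi q : R^o).
  by apply: cvgB; apply: continuous_cvg => //; exact: psi_cont.
rewrite pq subrr => /cvgr0_norm_lt /(_ e e0) Ult.
by have [n []] := filter_ex (filterI Ue Ult).
Unshelve. all: by end_near. Qed.

End countably_separated.

(* Outside the countable union of the supports of the [F n], all coordinates
   vanish on the closure of the sequence. *)
Lemma Corson_sequence_separated (R : realType) (K : topologicalType)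
    (F : nat -> K) : Corson_compactum R K ->
  exists (L : set K) (phi : nat -> K -> R^o),
    [/\ closed L, forall n, L (F n), forall k, continuous (phi k)
      & forall a b, L a -> L b -> (forall k, phi k a = phi k b) -> a = b].
Proof.
move=> [_ _ [I]]; elim/Pchoice: I => I [C [_ [h [h' [hC _ hK _]]]]].
pose e (k : K) : I -> R^o := val (val (h k)).
have e_inj : injective e.
  by move=> a b /val_inj/val_inj ab; rewrite -(hK a) ab hK.
have e_cont i : continuous (fun k => e k i).
  move=> k; apply: (@continuous_comp _ _ _ (fun k => val (h k))
    (fun s : Sigma R I => val s i)).
    apply: (@continuous_comp _ _ _ h val); first exact: hC.
    exact: initial_continuous.
  apply: (@continuous_comp _ _ _ set_val (fun g : {ptws I -> R} => g i)).
    exact: initial_continuous.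
  exact: (@proj_continuous I (fun=> R) i).
have e_countable k : countable [set i | e k i != 0].
  exact: set_mem (valP (val (h k))).
pose J := \bigcup_(n in [set: nat]) [set i | e (F n) i != 0].
have /countable_injP[f f_inj] : countable J by exact: bigcup_countable.
(* [phi] lists the coordinates in [J] through the injection [f]; numbers that are not codes get the
   constant 0. *)
have /choice[phi phiP] n : exists psi : K -> R^o,
    continuous psi /\ forall i, J i -> f i = n -> psi = e ^~ i.
  have [[i [Ji <-]]|nJ] := pselect (exists i, J i /\ f i = n).
    exists (e ^~ i); split=> [|j Jj fji]; first exact: e_cont.
    by rewrite (f_inj i j) ?inE.
  exists (cst 0); split=> [|i Ji fi]; first exact: cst_continuous.
  by exfalso; apply: nJ; exists i.
exists [set k | forall i, ~ J i -> e k i = 0], phi; split.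
- rewrite (_ : mkset _ = \bigcap_(i in ~` J) ((e ^~ i) @^-1` [set 0])); last first.
    by apply/seteqP; split.
  apply: closed_bigI => i _; apply: (continuous_closedP (e ^~ i)).1; last exact: closed_eq.
  exact: e_cont.
- by move=> n i /= nJi; apply: contrapT => /eqP ei; apply: nJi; exists n.
- by move=> k; have [] := phiP k.
- move=> a b La Lb ab; apply: e_inj; apply/funext => i.
  have [Ji|nJi] := pselect (J i); last by rewrite La// Lb.
  by have [_ /(_ i Ji erefl) phiE] := phiP (f i); have := ab (f i); rewrite phiE.
Qed.

(** * Operator norms, operators into [c0], and the dual ball *)

Section opnorm.
Context (R : realType) (V W : normedModType R).

Lemma opnorm_le (f : V -> W) (C : R) : 0 <= C ->
  (forall x, `|f x| <= C * `|x|) -> opnorm f <= C.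
Proof.
move=> C0 fC; apply: sup_le_ub; first by exists `|f 0|, 0; rewrite /= ?normr0.
move=> _ [x x1 <-]; apply: le_trans (fC x) _.
by rewrite ler_piMr.
Qed.

Lemma opnorm_ge0 (f : V -> W) : 0 <= opnorm f.
Proof.
(* For unbounded [f] the supremum takes its default value 0, so no boundedness is assumed. *)
have [supf|/sup_out supf] :=
    pselect (has_sup [set `|f x| | x in [set x : V | `|x| <= 1]]); last first.
  by rewrite /opnorm supf.
apply: le_trans (normr_ge0 (f 0)) _; apply: sup_upper_bound => //.
by exists 0; rewrite //= normr0.
Qed.

Lemma le_opnorm (f : {linear V -> W}) : bounded_near f (nbhs (0 : V)) ->
  forall x, `|f x| <= opnorm f * `|x|.
Proof.
move=> /linear_boundedP /pinfty_ex_gt0 [r r0 fr] x.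
have supf : has_sup [set `|f x| | x in [set x : V | `|x| <= 1]].
  split; first by exists `|f 0|, 0; rewrite /= ?normr0.
  exists r => _ [y y1 <-]; apply: le_trans (fr y) _.
  by rewrite ler_piMr// ltW.
have [->|x0] := eqVneq x 0; first by rewrite linear0 !normr0 mulr0.
rewrite -ler_pdivrMr ?normr_gt0// mulrC -[X in X * _]ger0_norm ?invr_ge0//.
rewrite -normrZ -linearZ; apply: sup_upper_bound => //.
exists (`|x|^-1 *: x) => //=.
by rewrite normrZ ger0_norm ?invr_ge0// mulVf ?normr_eq0.
Qed.

End opnorm.

Lemma linear_c0 (R : realType) (X : lmodType R) (f : nat -> {linear X -> R^o}) :
  (forall x, f n x @[n --> \oo] --> (0 : R^o)) ->
  exists T : {linear X -> c0 R}, forall x n, val (T x) n = f n x.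
Proof.
move=> f0; have f0' x : (fun n => f n x) \in @c0_pred R by exact/asboolP.
pose T x : c0 R := Sub (fun n => f n x) (f0' x).
have Tlin : linear T.
  by move=> a x y; apply: val_inj; apply/funext => n /=; rewrite linearP.
by have [T' T'E] := linear_funP Tlin; exists T' => x n; rewrite T'E.
Qed.

Section dual_ball.
Context (R : realType) (X : normedModType R).

Lemma mem_dual_ball (f : {linear X -> R^o}) :
  (forall x, `|f x| <= `|x|) -> (f : {ptws X -> R^o}) \in dual_ball X.
Proof.
move=> f1; apply/mem_set; split; first exact: linearP.
- by apply/linear_boundedP; near=> r => x; apply: le_trans (f1 x) _;
    rewrite ler_peMl//; near: r; exact: nbhs_pinfty_ge.
- by apply: opnorm_le => // x; rewrite mul1r.
Unshelve. all: by end_near. Qed.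

Lemma dual_ballP (k : dual_ball X) :
  exists2 f : {linear X -> R^o}, f = val k :> (X -> R^o) & forall x, `|f x| <= `|x|.
Proof.
have [/linear_funP[f fE] kb k1] := set_mem (valP k).
exists f => // x; rewrite -fE in kb k1; apply: le_trans (le_opnorm kb x) _.
by rewrite ler_piMl.
Qed.

Lemma dual_ball_eval_continuous (x : X) :
  continuous (fun k : dual_ball X => val k x : R^o).
Proof.
move=> k; apply: (@continuous_comp _ _ _ set_val (fun g : {ptws X -> R^o} => g x)).
  exact: initial_continuous.
exact: (@proj_continuous X (fun=> R^o) x).
Qed.

End dual_ball.

Lemma c0_coord_le (R : realType) (u : c0 R) n : `|val u n| <= `|u|.
Proof. by apply: sup_upper_bound; [exact: c0_has_sup|exists n]. Qed.

Lemma c0_norm_le (R : realType) (u : c0 R) (M : R) :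
  (forall n, `|val u n| <= M) -> `|u| <= M.
Proof.
by move=> uM; apply: sup_le_ub => [|_ [n _ <-]//]; case: (c0_has_sup u).
Qed.

(** * Construction of the extension *)

Theorem corollary2p6 (R : realType) (X : completeNormedModType R) :
  weakly_Lindelof_determined X -> c0_extension_property X 2.
Proof.
move=> wld Y T _ Tb; set M := opnorm T.
have M0 : 0 <= M := opnorm_ge0 T.
have TM := le_opnorm Tb.
have M2 : 0 <= 2 * M by rewrite mulr_ge0.
(* An operator into [c0] is built from its coordinates: a pointwise null sequence of functionals,
   whose common bound becomes the norm bound. *)
suff [f [fM fY f0]] : exists f : nat -> {linear X -> R^o},
    [/\ forall n x, `|f n x| <= 2 * M * `|x|,
      forall n (y : submod Y), f n (val y) = val (T y) n
    & forall x, f n x @[n --> \oo] --> (0 : R^o)].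
  have [T' T'E] := linear_c0 f0.
  have T'M x : `|T' x| <= 2 * M * `|x|.
    by apply: c0_norm_le => n; rewrite T'E.
  exists T'; split; last exact: opnorm_le.
    apply/linear_boundedP; near=> r => x; apply: le_trans (T'M x) _.
    by rewrite ler_wpM2r//; near: r; exact: nbhs_pinfty_ge.
  by move=> y; apply: val_inj; apply/funext => n; rewrite T'E fY.
(* The scaling by [M^-1] below needs [M] nonzero; when [M = 0], [T] vanishes and the zero
   functionals extend it. *)
have [M_eq0|M_neq0] := eqVneq M 0.
  exists (fun=> \0); split=> [n x|n y|x]; last exact: cvg_cst.
    by rewrite normr0 mulr_ge0.
  have Ty : T y = 0 by apply/eqP; rewrite -normr_le0 -[leRHS](mul0r `|y|) -M_eq0.
  by rewrite Ty.
have M_gt0 : 0 < M by rewrite lt_def M_neq0.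
have extF n : exists F : dual_ball X, forall y : submod Y,
    M * val F (val y) = val (T y) n.
  have lTn : linear (fun y => M^-1 * val (T y) n : R^o).
    by move=> a y z; rewrite !linearP /= mulrDr; congr (_ + _); rewrite mulrCA.
  have [Tn TnE] := linear_funP lTn.
  have [y|F [FY Fle]] := hahn_banach_dominated (f := Tn) ler01.
    rewrite mul1r TnE normrM gtr0_norm ?invr_gt0// ler_pdivrMl//.
    exact: le_trans (c0_coord_le _ _) (TM y).
  have F1 : (F : {ptws X -> R^o}) \in dual_ball X.
    by apply: mem_dual_ball => x; have := Fle x; rewrite mul1r.
  by exists (SigSub F1) => y; rewrite /= FY TnE mulVKf.
have {extF} [F FY] := choice extF.
have [Kco _ _] := wld.
have [L [phi [Lcl LF phi_cont phi_sep]]] := Corson_sequence_separated F wld.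
pose A : set (dual_ball X) := [set k | forall y : submod Y, val k (val y) = 0].
have A0 : A !=set0.
  have m0 : ((\0 : {linear X -> R^o}) : {ptws X -> R^o}) \in dual_ball X.
    by apply: mem_dual_ball => x /=; rewrite normr0.
  by exists (SigSub m0).
have FA : cluster (F @ \oo) `<=` A.
  (* Along a filter [G] finer than [F @ \oo] and converging to [k], evaluation at [y] tends both to
     [k y] and to the limit 0 of [M^-1 * T y n]. *)
  move=> k; rewrite cluster_cvgE => -[G PG [Gk FG]] y.
  have evG : val l (val y) @[l --> G] --> (val k (val y) : R^o).
    exact: cvg_comp Gk (@dual_ball_eval_continuous R X (val y) k).
  have ev0 : val l (val y) @[l --> G] --> (0 : R^o).
    have Ty0 : val (F n) (val y) @[n --> \oo] --> (0 : R^o).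
      under eq_fun do rewrite -(mulKf M_neq0 (val (F _) _)) FY.
      by rewrite -(mulr0 M^-1); apply: cvgMl_tmp; exact: asboolW (valP (T y)).
    by move=> B B0; apply: FG; exact: Ty0.
  exact: cvg_unique evG ev0.
have [g [gA gF]] := cvg_sub_cluster_subset Kco Lcl phi_cont phi_sep A0 LF FA.
have /choice[f fE] n : exists f : {linear X -> R^o},
    forall x, f x = M * (val (F n) x - val (g n) x).
  have [Fl <- _] := dual_ballP (F n); have [gl <- _] := dual_ballP (g n).
  by exists (M \*: (Fl \- gl)).
exists f; split=> [n x|n y|x].
- rewrite fE normrM gtr0_norm// mulrAC mulrC ler_wpM2r//.
  have [Fl <- Fl1] := dual_ballP (F n); have [gl <- gl1] := dual_ballP (g n).
  by rewrite (le_trans (ler_normB _ _))// mulr_natl mulr2n lerD.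
- by rewrite fE gA subr0 FY.
- under eq_fun do rewrite fE.
  rewrite -(mulr0 M); apply: cvgMl_tmp.
  exact: gF (@dual_ball_eval_continuous R X x).
Unshelve. all: by end_near. Qed.
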